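(* A positive integer $m$ is the sum of three octahedral numbers (that is, $m=\mathscr{O}_{a}+\mathscr{O}_{b}+\mathscr{O}_{c}$ for some integers $a,b,c\ge 1$) if and only if there is a vertex $v_{ij}$ ($i,j\ge 0$) lying in a non-trivial component of the graph $\Gamma_{\mathscr{O}}$ such that $m$ represents $v_{ij}$ in $\mathscr{R}_{\mathscr{O}}$, i.e. $m=3+4i+5j$.
   Context: The $n$-th octahedral number ($n\ge 1$) is $\mathscr{O}_{n}=\frac{n(2n^{2}+1)}{3}$. The $s$-th tetrahedral number is $\rho_{s}=\frac{s(s+1)(s+2)}{6}$, with $\rho_{0}=0$. Write $g(s)=\rho_{s}-s$ for $s\ge 0$ (so $g(0)=g(1)=0$, $g(2)=2$, $g(3)=7$). The points are symbols $v_{ij}$ indexed by pairs of integers $i,j\ge 0$ (as a poset $\mathscr{R}$, the points with fixed $j$ form the infinite chain $v_{0j}<v_{1j}<v_{2j}<\cdots$, and different chains are incomparable). In the representation $\mathscr{R}_{\mathscr{O}}$ the point $v_{ij}$ is represented by the number $n_{ij}=3+4i+5j$. The graph $\Gamma_{\mathscr{O}}$ has vertex set $\{v_{ij}: i,j\ge 0\}$, and its arrows are exactly those joining consecutive vertices of the following paths (where $v_{(x)(y)}$ denotes the vertex with first index $x$ and second index $y$): (1) the left boundary path, whose vertices in order are $v_{(g(s))(s)}$, $s=0,1,2,\dots$; (2) for all integers $i_{0},j\ge 0$, the path whose vertices in order are $v_{(g(i_{0})+g(k))(i_{0}+k)}$, $k=0,1,\dots,j$; (3) for all integers $i_{0},j\ge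 0$, the path whose vertices in order are $v_{(g(i_{0})+g(j)+g(l))(i_{0}+j+l)}$, $l=0,1,\dots,j$. A component of the graph means a connected component of the underlying undirected graph; it is non-trivial if it contains at least one arrow (i.e. it is not a single isolated vertex). *)

(* Defs.v *)
From Stdlib Require Import Relation_Operators.
From mathcomp Require Import all_boot.
From mathcomp Require Import zify.

Set Implicit Arguments.
Unset Strict Implicit.
Unset Printing Implicit Defensive.

(* The divisions and the subtraction below are exact: see [octahedralE],
   [tetrahedralE] and [gE]. *)
Definition octahedral (n : nat) : nat := (n * (2 * n ^ 2 + 1)) %/ 3.

Definition tetrahedral (s : nat) : nat := (s * (s + 1) * (s + 2)) %/ 6.

Definition g (s : nat) : nat := tetrahedral s - s.

Lemma octahedralE (n : nat) : octahedral n * 3 = n * (2 * n ^ 2 + 1).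
Proof.
apply: divnK; elim: n => // n IHn.
have -> : n.+1 * (2 * n.+1 ^ 2 + 1) =
          n * (2 * n ^ 2 + 1) + (2 * n ^ 2 + 2 * n + 1) * 3.
  by rewrite !expnS !expn0; nia.
by rewrite dvdn_add // dvdn_mull.
Qed.

Lemma tetrahedralE (s : nat) : tetrahedral s * 6 = s * (s + 1) * (s + 2).
Proof.
apply: divnK; elim: s => // s IHs.
have [t Ht] : exists t, s.+1 * s.+2 = t * 2.
  elim: s {IHs} => [|s [t Ht]]; first by exists 1.
  by exists (t + s.+2); nia.
have -> : s.+1 * (s.+1 + 1) * (s.+1 + 2) = s * (s + 1) * (s + 2) + t * 6.
  by nia.
by rewrite dvdn_add // dvdn_mull.
Qed.

Lemma gE (s : nat) : g s + s = tetrahedral s.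
Proof. by apply: subnK; have := tetrahedralE s; case: s => // s; nia. Qed.

(* The pair (i, j) is the point v_ij, in position i of the j-th chain. *)
Definition vertex : Type := (nat * nat)%type.

Definition rep (v : vertex) : nat := 3 + 4 * v.1 + 5 * v.2.

Definition boundary_path (s : nat) : vertex := (g s, s).

Definition path2 (i0 k : nat) : vertex := (g i0 + g k, i0 + k).

Definition path3 (i0 j l : nat) : vertex := (g i0 + g j + g l, i0 + j + l).

(* For each (i0, j) there is one path [path2 i0] with indices 0..j and one path
   [path3 i0 j] with indices 0..j; the boundary path is infinite. *)
Inductive arrow : vertex -> vertex -> Prop :=
| ArrowBoundary (s : nat) :
    arrow (boundary_path s) (boundary_path s.+1)
| Arrow2 (i0 j k : nat) : k < j ->
    arrow (path2 i0 k) (path2 i0 k.+1)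
| Arrow3 (i0 j l : nat) : l < j ->
    arrow (path3 i0 j l) (path3 i0 j l.+1).

Definition component (v : vertex) : vertex -> Prop :=
  clos_refl_sym_trans vertex arrow v.

Definition nontrivial (C : vertex -> Prop) : Prop :=
  exists x y : vertex, [/\ C x, C y & arrow x y].

(* Main.v *)
Require Import Defs.
From mathcomp Require Import all_boot.
From Stdlib Require Import Relation_Operators.
From mathcomp Require Import zify.

(** Since [octahedral s.+1 = 1 + 4 * g s + 5 * s], a sum of three octahedral
    numbers with indices [a.+1], [b.+1], [c.+1] represents the vertex
    [path3 a b c].  A vertex has a non-trivial component exactly when it is an
    endpoint of an arrow, and, [g 0] being [0], the endpoints of arrows are
    exactly the vertices [path3 a b c]. *)

(** Once the divisions by 3 and 6 and the subtraction in [g] are cleared, this is a polynomial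
    identity in [s]. *)
Lemma octahedralS (s : nat) : octahedral s.+1 = 1 + 4 * g s + 5 * s.
Proof.
have := octahedralE s.+1; have := tetrahedralE s; have := gE s.
by rewrite -mulnn; nia.
Qed.

Lemma rep_path3 (a b c : nat) :
  rep (path3 a b c) = octahedral a.+1 + octahedral b.+1 + octahedral c.+1.
Proof. by rewrite !octahedralS /rep /path3 /=; lia. Qed.

Lemma g0 : g 0 = 0.
Proof. by []. Qed.

Lemma boundary_path3 (s : nat) : boundary_path s = path3 s 0 0.
Proof. by rewrite /path3 g0 !addn0. Qed.

Lemma path2_path3 (i k : nat) : path2 i k = path3 i k 0.
Proof. by rewrite /path3 g0 !addn0. Qed.

Lemma path3C (a b c : nat) : path3 a b c = path3 a c b.
Proof. by rewrite /path3 addnAC [a + b + c]addnAC. Qed.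

Definition incident (v : vertex) : Prop := exists w, arrow v w \/ arrow w v.

(** Both ends of a single arrow are incident, and the closure rules preserve equivalence. *)
Lemma component_incident (v w : vertex) :
  component v w -> incident v <-> incident w.
Proof.
elim=> [x y xy | x | x y _ IH | x y z _ IHxy _ IHyz] //.
- by split=> _; [exists x; right | exists y; left].
- by split=> /IH.
- by rewrite IHxy.
Qed.

Lemma nontrivial_componentP (v : vertex) :
  nontrivial (component v) <-> incident v.
Proof.
split=> [[x [y [vx _ xy]]] | [w [vw | wv]]].
- by apply/(component_incident _ _ vx); exists y; left.
- by exists v, w; split=> //; [exact: rst_refl | exact: rst_step].
- exists w, v; split=> //; last exact: rst_refl.
  by apply: rst_sym; exact: rst_step.
Qed.

Lemma arrow_path3 (v w : vertex) :
  arrow v w ->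
  (exists a b c, v = path3 a b c) /\ (exists a b c, w = path3 a b c).
Proof.
case=> [s | i j k _ | i j l _].
- by split; [exists s, 0, 0 | exists s.+1, 0, 0]; exact: boundary_path3.
- by split; [exists i, k, 0 | exists i, k.+1, 0]; exact: path2_path3.
- by split; [exists i, j, l | exists i, j, l.+1].
Qed.

Lemma path3_incident (a b c : nat) : incident (path3 a b c).
Proof.
(* [Arrow3] bounds the last index by the middle one; [path3C] lets these two be ordered. *)
wlog le_cb : b c / c <= b => [IH|].
  by case/orP: (leq_total c b) => [/IH // | /IH]; rewrite path3C.
have [lt_cb | le_bc] := ltnP c b.
  by exists (path3 a b c.+1); left; exact: Arrow3.
have -> : c = b by lia.
case: b {le_cb le_bc} => [|b].
  (* For [b = c = 0] the path [path3 a 0] has no arrow, but the boundary path leaves its only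
     vertex. *)
  by exists (boundary_path a.+1); left; rewrite -boundary_path3; constructor.
(* The vertex ends the path [path3 a b.+1], so the arrow entering it is used. *)
by exists (path3 a b.+1 b); right; exact: Arrow3.
Qed.

Lemma incident_path3P (v : vertex) :
  incident v <-> exists a b c, v = path3 a b c.
Proof.
split=> [[w [/arrow_path3 [] // | /arrow_path3 [] //]] | [a [b [c ->]]]].
exact: path3_incident.
Qed.

Theorem theorem13 (m : nat) (hm : 0 < m) :
  (exists a b c : nat,
      [/\ 1 <= a, 1 <= b, 1 <= c &
          m = octahedral a + octahedral b + octahedral c])
  <->
  (exists i j : nat, nontrivial (component (i, j)) /\ m = rep (i, j)).
Proof.
(* Positivity excludes index 0, leaving the successors that [rep_path3] expects. *)
split=> [[[|a] [[|b] [[|c] [//= _ _ _ ->]]]] | [i [j []]]].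
  exists (path3 a b c).1, (path3 a b c).2; split; last by rewrite -rep_path3.
  by apply/nontrivial_componentP; exact: path3_incident.
move/nontrivial_componentP/incident_path3P=> [a [b [c ->]]] ->.
by exists a.+1, b.+1, c.+1; split=> //; exact: rep_path3.
Qed.
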